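(* Let $\mathcal M$ be the family of all sets $A\subset\mathbb R$ with $\chi_A\in R_2$, and let $\mu(A):=\int\chi_A\,dx$ for $A\in\mathcal M$. Then $\mu$ is a $\sigma$-finite, complete measure on $\mathcal M$.
   Context: A set $N\subset\mathbb R$ is a null set if for each $\varepsilon>0$ it has a countable cover by intervals of total length $<\varepsilon$; a property holds almost everywhere (a.e.) if it holds outside a null set. Functions (with values in $[-\infty,\infty]$, defined a.e. on $\mathbb R$) that are equal a.e. are identified. $f_n\nearrow f$ means that $f_n\le f_{n+1}$ for all $n$ and $f_n\to f$, a.e. $\chi_A$ is the characteristic function of $A$. A step function is a function of the form $\varphi=\sum_{i=1}^m c_i\chi_{I_i}$ with bounded intervals $I_i\subset\mathbb R$ and real numbers $c_i$; its integral is $\int\varphi\,dx:=\sum_{i=1}^m c_i|I_i|$, where $|I_i|$ is the length of $I_i$ (this does not depend on the representation). $R_0$ denotes the vector lattice of step functions. $R_1$ is the class of functions $f:\mathbb R\to[-\infty,\infty]$ for which there exists $(\varphi_n)\subset R_0$ with $\varphi_n\nearrow f$, and then $\int f\,dx:=\lim\int\varphi_n\,dx\in(-\infty,\infty]$ (this does not depend on the choice of $(\varphi_n)$). $R_2$ is the class of functions $f$ which can be written (a.e.) as $f=f_1-f_2$ with $f_1,f_2\in R_1$ such that at least one of $\int f_1\,dx$, $\int f_2\,dx$ is finite (then $f_1-f_2$ is defined a.e.); then $\int f\,dx:=\int f_1\,dx-\int f_2\,dx\in[-\infty,\infty]$ (this does not depend on the choice of $f_1,f_2$). Given a family $\mathcal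 A$ of subsets of a set $X$ with $\varnothing\in\mathcal A$, a measure on $\mathcal A$ is a nonnegative function $\mu:\mathcal A\to[0,\infty]$ such that $\mu(\varnothing)=0$ and $\mu(A)=\sum_{n=1}^\infty\mu(A_n)$ whenever $A\in\mathcal A$ is the disjoint union of a sequence $(A_n)\subset\mathcal A$. It is $\sigma$-finite if each $A\in\mathcal A$ has a countable cover by sets (of $\mathcal A$) of finite measure, and complete if all subsets of a set of measure zero also belong to $\mathcal A$. *)

(* Defs.v *)
From HB Require Import structures.
From mathcomp Require Import all_boot all_order all_algebra.
From mathcomp Require Import all_classical all_reals all_analysis.
Import Order.TTheory GRing.Theory Num.Theory.
Import numFieldNormedType.Exports.

Set Implicit Arguments.
Unset Strict Implicit.
Unset Printing Implicit Defensive.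

Local Open Scope classical_set_scope.
Local Open Scope ring_scope.

(* Extended-real functions defined a.e. and identified when equal a.e. are
   represented by total functions R -> \bar R; in_R1, in_R2 and the integrals
   below see such a function only up to null sets.

   The integrals do not depend on the chosen representations, but this is a
   theorem. They are defined here by choosing, with xget, one of the values
   given by the representations; the default 0 is used only when there is no
   representation, that is, outside the class considered. *)

Section NullSets.
Variable R : realType.

(* wlength idfun I is the length of the interval I, in \bar R. Empty
   intervals are allowed, so finite covers are included. *)
Definition is_null_set (N : set R) : Prop :=
  forall e : R, 0 < e ->
    exists2 I : nat -> interval R,
      N `<=` \bigcup_k [set` I k] &
      (\sum_(0 <= k <oo) wlength idfun [set` I k] < e%:E)%E.

Definition almost_everywhere_R (P : R -> Prop) : Prop :=
  exists2 N : set R, is_null_set N & forall x, ~ N x -> P x.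

End NullSets.

Section Integral.
Variable R : realType.

Definition itv_bounded (i : interval R) : bool :=
  if i is Interval (BSide _ _) (BSide _ _) then true else false.

Definition step_repr (s : seq (R * interval R)) (phi : R -> R) : Prop :=
  all (fun ci => itv_bounded ci.2) s /\
  forall x, phi x = \sum_(ci <- s) ci.1 * \1_[set` ci.2] x.

(* fine is harmless: the length is finite on bounded intervals. *)
Definition step_sum (s : seq (R * interval R)) : R :=
  \sum_(ci <- s) ci.1 * fine (wlength idfun [set` ci.2]).

Definition in_R0 (phi : R -> R) : Prop := exists s, step_repr s phi.

Definition int_R0 (phi : R -> R) : R :=
  xget 0 [set v | exists2 s, step_repr s phi & v = step_sum s].

Definition ae_increasing_to (phi : nat -> R -> R) (f : R -> \bar R) : Prop :=
  almost_everywhere_R (fun x =>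
    (forall n, phi n x <= phi n.+1 x) /\
    (phi n x)%:E @[n --> \oo] --> f x).

Definition R1_approx (f : R -> \bar R) (phi : nat -> R -> R) : Prop :=
  (forall n, in_R0 (phi n)) /\ ae_increasing_to phi f.

Definition in_R1 (f : R -> \bar R) : Prop := exists phi, R1_approx f phi.

Definition int_R1 (f : R -> \bar R) : \bar R :=
  xget 0%E [set v | exists2 phi, R1_approx f phi &
                    (int_R0 (phi n))%:E @[n --> \oo] --> v].

(* The convention -oo for the difference +oo - +oo is irrelevant: when one of
   the integrals is finite, f1 x - f2 x is determinate for a.e. x. *)
Definition R2_decomp (f f1 f2 : R -> \bar R) : Prop :=
  [/\ in_R1 f1, in_R1 f2,
      int_R1 f1 \is a fin_num \/ int_R1 f2 \is a fin_num &
      almost_everywhere_R (fun x => f x = (f1 x - f2 x)%E)].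

Definition in_R2 (f : R -> \bar R) : Prop := exists f1 f2, R2_decomp f f1 f2.

Definition int_R2 (f : R -> \bar R) : \bar R :=
  xget 0%E [set v | exists f1 f2,
    R2_decomp f f1 f2 /\ v = (int_R1 f1 - int_R1 f2)%E].

Definition chi (A : set R) : R -> \bar R := fun x => (\1_A x)%:E.

Definition R2_sets : set (set R) := [set A | in_R2 (chi A)].

Definition R2_measure (A : set R) : \bar R := int_R2 (chi A).

End Integral.

Arguments R2_sets R : clear implicits.
Arguments R2_measure R : clear implicits.

(* The family AA need not be a semiring of sets, so the measure structures of
   the library, which live on such families, do not apply. A set function on
   AA is represented by a total function whose values outside AA are not
   used. *)
Section MeasureOnFamily.
Variables (R : realType) (X : Type).
Variables (AA : set (set X)) (mu : set X -> \bar R).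

Definition is_measure_on : Prop :=
  [/\ AA set0,
      forall A, AA A -> (0 <= mu A)%E,
      mu set0 = 0%E &
      forall F : nat -> set X,
        (forall n, AA (F n)) -> trivIset setT F -> AA (\bigcup_n F n) ->
        mu (\bigcup_n F n) = (\sum_(0 <= n <oo) mu (F n))%E].

Definition is_sigma_finite_on : Prop :=
  forall A, AA A ->
    exists2 F : nat -> set X,
      (forall n, AA (F n) /\ (mu (F n) < +oo)%E) &
      A `<=` \bigcup_n F n.

Definition is_complete_on : Prop :=
  forall A B, AA A -> mu A = 0%E -> B `<=` A -> AA B.

End MeasureOnFamily.

(* Main.v *)
(** The null sets of the definitions are the negligible sets of the Lebesgue
measure [mu] of the library, since both are described by countable covers by
intervals. A function of class R1 is a.e. equal to a Borel function bounded
below by an integrable one, and by monotone convergence [int_R1] is its Lebesgue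
integral. Hence every [A] with [chi A] in R2 agrees a.e. with a Borel set [B],
and [R2_measure R A = mu B]; countable additivity is inherited from [mu] after
removing one common null set from the Borel sets.

Only this direction is needed: membership of a union in the family is part of
the hypothesis of countable additivity, and the bounded intervals suffice for
sigma-finiteness. *)

Require Import Defs.
From mathcomp Require Import all_boot all_order all_algebra.
From mathcomp Require Import all_classical all_reals all_analysis.
From mathcomp Require Import measurable_realfun.
Import Order.TTheory GRing.Theory Num.Theory.
Import numFieldNormedType.Exports.

Set Implicit Arguments.
Unset Strict Implicit.
Unset Printing Implicit Defensive.

Local Open Scope classical_set_scope.
Local Open Scope ring_scope.

Section LebesgueComparison.
Variable R : realType.
Local Notation mu := (@lebesgue_measure R).
Local Notation borel g := (measurable_fun [set: measurableTypeR R] g).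

(** * Null sets and almost-everywhere reasoning *)

Lemma wlength_idfun_itv (i : interval R) :
  wlength idfun [set` i] = mu [set` i].
Proof. by rewrite wlength_itv lebesgue_measure_itv !er_map_idfun. Qed.

(** From left to right, the covers of total length below [1/(n+1)] intersect, over all [n], in a
    Borel set of measure zero. Conversely, [mu] comes from an outer measure, an infimum over covers
    by intervals. *)
Lemma null_set_negligible (N : set R) : is_null_set N <-> mu.-negligible N.
Proof.
split=> [N0|[A [mA A0 NA]] e e0].
- have /choice[I IP] : forall n : nat, exists I : nat -> interval R,
      N `<=` \bigcup_k [set` I k] /\
      (\sum_(0 <= k <oo) wlength idfun [set` I k] < n.+1%:R^-1%:E)%E.
    move=> n; have [|I NI Ie] := N0 n.+1%:R^-1; first by rewrite invr_gt0 ltr0n.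
    by exists I.
  pose A := \bigcap_n \bigcup_k [set` I n k].
  have mI n : measurable (\bigcup_k [set` I n k] : set (measurableTypeR R)).
    by apply: bigcup_measurable => k _; exact: measurable_itv.
  have mA : measurable (A : set (measurableTypeR R)).
    by apply: bigcap_measurable => // n _; exact: mI.
  exists A; split => //; last by move=> x Nx n _; exact: (IP n).1.
  apply/eqP; rewrite eq_le measure_ge0 andbT.
  apply/lee_addgt0Pr => e e0; rewrite add0e.
  pose n := Num.truncn e^-1.
  have ne : n.+1%:R^-1 < e by rewrite invf_plt ?posrE ?ltr0n// truncnS_gt.
  apply: (@le_trans _ _ n.+1%:R^-1%:E); last by rewrite lee_fin (ltW ne).
  have [_ /ltW] := IP n; apply: le_trans.
  under eq_eseriesr do rewrite wlength_idfun_itv.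
  apply: measure_sigma_subadditive => //.
  by move=> x; apply.
- have : (mu A < e%:E)%E by rewrite A0 lte_fin.
  (* Unfolding exposes [mu A] as the infimum of the total lengths of covers by half-open
     intervals. *)
  rewrite /lebesgue_measure /lebesgue_stieltjes_measure /measure_extension.
  move=> /ereal_inf_lt[_ [F [mF AF] <-]] Fe.
  have /choice[I FI] : forall k, exists i : interval R, F k = [set` i].
    by move=> k; have [[a b] _ <-] := mF k; exists `]a, b].
  exists I; last by under eq_eseriesr do rewrite -FI.
  apply: (subset_trans NA); apply: (subset_trans AF).
  by move=> x [k _ Fkx]; exists k => //; rewrite -FI.
Qed.

Lemma ae_foralln_R (P : nat -> R -> Prop) :
  (forall n, almost_everywhere_R (P n)) ->
  almost_everywhere_R (fun x => forall n, P n x).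
Proof.
move=> aeP; have /choice[N NP] : forall n, exists N : set R,
    is_null_set N /\ forall x, ~ N x -> P n x.
  by move=> n; have [N] := aeP n; exists N.
exists (\bigcup_n N n).
  apply/null_set_negligible; apply: negligible_bigcup => n.
  exact/null_set_negligible/(NP n).1.
by move=> x Nx n; apply: (NP n).2 => Nnx; apply: Nx; exists n.
Qed.

Lemma aeS_R (P Q : R -> Prop) : (forall x, P x -> Q x) ->
  almost_everywhere_R P -> almost_everywhere_R Q.
Proof. by move=> PQ [N N0 NP]; exists N => // x /NP/PQ. Qed.

Lemma aeS2_R (P Q S : R -> Prop) : (forall x, P x -> Q x -> S x) ->
  almost_everywhere_R P -> almost_everywhere_R Q -> almost_everywhere_R S.
Proof.
move=> PQS aeP aeQ.
(* The pair is read as the sequence [P, Q, Q, ...]. *)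
have /ae_foralln_R : forall n : nat,
  almost_everywhere_R (if n is 0 then P else Q) by case.
by apply: aeS_R => x PQ; exact: PQS (PQ 0%N) (PQ 1%N).
Qed.

(** With a Borel exceptional set, functions can be cut off and sets trimmed without losing
    measurability. *)
Lemma ae_measurable_R (P : R -> Prop) : almost_everywhere_R P <->
  exists A : set (measurableTypeR R),
    [/\ measurable A, mu A = 0%E & forall x, ~ A x -> P x].
Proof.
split=> [[N /null_set_negligible[A [mA A0 NA]] NP]|[A [mA A0 AP]]].
  by exists A; split => // x Ax; apply: NP => /NA.
by exists A; [apply/null_set_negligible; exists A; split|exact: AP].
Qed.

Lemma ae_eq_integral_R (f g : R -> \bar R) : borel f -> borel g ->
  almost_everywhere_R (fun x => f x = g x) ->
  (\int[mu]_x f x = \int[mu]_x g x)%E.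
Proof.
move=> mf mg /ae_measurable_R[A [mA A0 Afg]]; apply: ae_eq_integral => //.
by exists A; split => // x /= nfg; apply: contrapT => /Afg fg; exact: nfg.
Qed.

(** * Step functions and the class R1 in terms of the Lebesgue integral *)

Lemma itv_boundedP (i : interval R) :
  itv_bounded i -> exists a b x y, i = Interval (BSide x a) (BSide y b).
Proof. by case: i => -[x a|//] [y b|//] _; exists a, b, x, y. Qed.

Lemma integrable_itv_bounded (i : interval R) : itv_bounded i ->
  mu.-integrable setT (EFin \o \1_[set` i]).
Proof.
by move=> /itv_boundedP[a [b [x [y ->]]]]; exact: integrable_indic_itv.
Qed.

(** The Lebesgue integral sees only [phi], so [step_sum s] is the same for all representations, and
    the choice made in [int_R0] is harmless. *)
Lemma step_repr_integral (s : seq (R * interval R)) phi : step_repr s phi ->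
  mu.-integrable setT (EFin \o phi) /\
  (\int[mu]_x (phi x)%:E)%E = (step_sum s)%:E.
Proof.
move=> []; elim: s phi => [|[c i] s IHs] phi /=.
  move=> _ phiE; have -> : phi = cst 0.
    by apply/funext => x; rewrite phiE big_nil.
  split; first exact: integrable0.
  by rewrite integral0 /step_sum big_nil.
move=> /andP[bi bs] phiE.
pose psi x := \sum_(ci <- s) ci.1 * \1_[set` ci.2] x.
have [ipsi psiE] := IHs psi bs (fun x => erefl).
have ii := integrable_itv_bounded bi.
have iZ : mu.-integrable setT (fun x : R => c%:E * (\1_[set` i] x)%:E)%E.
  exact: integrableZl.
have -> : phi = (fun x => c * \1_[set` i] x + psi x).
  by apply/funext => x; rewrite phiE big_cons.
split; first exact: integrableD iZ ipsi.
under eq_integral do rewrite EFinD EFinM.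
rewrite integralD// psiE integralZl// integral_indic// setIT.
rewrite /step_sum big_cons EFinD /= EFinM wlength_idfun_itv fineK//.
move: bi => /itv_boundedP[a [b [x [y ->]]]].
by rewrite lebesgue_measure_itv /=; case: ifP.
Qed.

Lemma int_R0E (phi : R -> R) : in_R0 phi ->
  (int_R0 phi)%:E = (\int[mu]_x (phi x)%:E)%E.
Proof.
move=> [s sphi]; rewrite /int_R0; case: xgetP => [_ _ [t tphi ->]|/(_ (step_sum s))].
  by rewrite (step_repr_integral tphi).2.
by case; exists s.
Qed.

Lemma in_R0_integrable (phi : R -> R) : in_R0 phi ->
  mu.-integrable setT (EFin \o phi).
Proof. by move=> [s /step_repr_integral[]]. Qed.

(* Adding an integrable [h >= |phi 0|] makes all the integrals involved
   integrals of nonnegative functions; [h] is left free so that two approximating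
   sequences, or two functions, can be compared with the same [h]. *)
Lemma R1_approx_lebesgue (f : R -> \bar R) (phi : nat -> R -> R) :
  R1_approx f phi ->
  exists g : R -> \bar R, [/\ borel g,
    almost_everywhere_R (fun x => f x = g x),
    forall x, ((- `|phi 0%N x|)%:E <= g x)%E &
    forall h : R -> R, mu.-integrable setT (EFin \o h) ->
      (forall x, `|phi 0%N x| <= h x) ->
      (int_R0 (phi n))%:E @[n --> \oo] -->
        (\int[mu]_x (g x + (h x)%:E) - \int[mu]_x (h x)%:E)%E].
Proof.
move=> [phiR0 /ae_measurable_R[A [mA A0 AP]]].
(* Cutting off at [A] makes monotonicity and convergence hold everywhere. *)
pose g x := (f x * (\1_(~` A) x)%:E)%E.
pose psi n x := phi n x * \1_(~` A) x.
have nA0 x : A x -> \1_(~` A) x = 0 :> R.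
  by move=> Ax; rewrite indicE memNset//= => /(_ Ax).
have nA1 x : ~ A x -> \1_(~` A) x = 1 :> R.
  by move=> Ax; rewrite indicE mem_set.
have psi_cvg x : (psi n x)%:E @[n --> \oo] --> g x.
  rewrite /psi /g; have [Ax|Ax] := pselect (A x).
    rewrite nA0// mule0; under eq_fun do rewrite mulr0; exact: cvg_cst.
  by rewrite nA1// mule1; under eq_fun do rewrite mulr1; exact: (AP x Ax).2.
have psi_nd x : {homo psi^~ x : m n / (m <= n)%N >-> m <= n}.
  apply/nondecreasing_seqP => n; rewrite /psi.
  have [Ax|Ax] := pselect (A x); first by rewrite nA0// !mulr0.
  by rewrite nA1// !mulr1; exact: (AP x Ax).1.
have psi0 x : - `|phi 0%N x| <= psi 0%N x.
  rewrite /psi; have [Ax|Ax] := pselect (A x).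
    by rewrite nA0// mulr0 oppr_le0.
  by rewrite nA1// mulr1 lerNnormlW.
have mphi n : borel (EFin \o phi n).
  exact: measurable_int (in_R0_integrable (phiR0 n)).
have mpsi n : borel (EFin \o psi n).
  apply/measurable_EFinP/measurable_funM; first exact/measurable_EFinP.
  exact/measurable_indic/measurableC.
exists g; split.
- by apply: emeasurable_fun_cvg => [n|x _]; [exact: mpsi|exact: psi_cvg].
- by apply/ae_measurable_R; exists A; split => // x Ax; rewrite /g nA1// mule1.
- move=> x; have /cvg_lim <- // := psi_cvg x.
  apply: lime_ge; first by apply/cvg_ex; exists (g x); exact: psi_cvg.
  by apply: nearW => n; rewrite lee_fin (le_trans (psi0 x))// psi_nd.
- move=> h ih hge.
  have mh : borel (EFin \o h).
    exact: measurable_int ih.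
  have intE n : (\int[mu]_x (psi n x + h x)%:E - \int[mu]_x (h x)%:E =
      (int_R0 (phi n))%:E)%E.
    rewrite int_R0E// (@ae_eq_integral_R _ (fun x => (phi n x)%:E + (h x)%:E)%E)//.
    + rewrite integralD//; last exact: in_R0_integrable.
      by rewrite addeK// integrable_fin_num.
    + exact: (emeasurable_funD (mpsi n) mh).
    + exact: (emeasurable_funD (mphi n) mh).
    + apply/ae_measurable_R; exists A; split => // x Ax.
      by rewrite /psi nA1// mulr1.
  under eq_fun do rewrite -intE.
  apply: cvgeB; last exact: cvg_cst.
    by rewrite fin_num_adde_defl// fin_numN integrable_fin_num.
  have -> : (\int[mu]_x (g x + (h x)%:E) =
      \int[mu]_x limn (fun n => (psi n x + h x)%:E))%E.
    apply: eq_integral => x _; apply/esym/cvg_lim => //.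
    under eq_fun do rewrite EFinD; apply: cvgeD => //; last exact: cvg_cst.
    by rewrite fin_num_adde_defl.
  apply: cvg_monotone_convergence => //.
  + by move=> n; exact: (emeasurable_funD (mpsi n) mh).
  (* Nonnegativity is the chain [- h x <= - |phi 0 x| <= psi 0 x <= psi n x]. *)
  + move=> n x _; rewrite lee_fin -lerBlDr sub0r.
    apply: le_trans (psi_nd x 0%N n (leq0n n)); apply: le_trans (psi0 x).
    by rewrite lerN2.
  + by move=> x _ m n mn; rewrite lee_fin lerD2r psi_nd.
Qed.

(** The limit does not depend on the sequence: [int_R1 f] is chosen through some [psi], and with the
    common shift [k], which dominates both [|phi 0|] and [|psi 0|], the two limits become the same
    expression in a.e. equal functions. *)
Lemma int_R1_cvg (f : R -> \bar R) (phi : nat -> R -> R) : R1_approx f phi ->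
  (int_R0 (phi n))%:E @[n --> \oo] --> int_R1 f.
Proof.
move=> fphi; have [g [mg fg _ gcvg]] := R1_approx_lebesgue fphi.
have integrable_norm0 psi : R1_approx f psi ->
    mu.-integrable setT (EFin \o (fun x => `|psi 0%N x|)).
  by move=> [psiR0 _]; apply: integrable_norm; exact: in_R0_integrable.
have iphi := integrable_norm0 _ fphi.
rewrite /int_R1; case: xgetP => [v _ [psi fpsi psicvg]|]; last first.
  (* The default value of [xget] cannot occur, since [phi] itself provides a limit. *)
  move=> /(_ (\int[mu]_x (g x + `|phi 0%N x|%:E) -
    \int[mu]_x `|phi 0%N x|%:E)%E) []; exists phi => //.
  exact: gcvg iphi (fun=> lexx _).
have [g' [mg' fg' _ g'cvg]] := R1_approx_lebesgue fpsi.
have ipsi := integrable_norm0 _ fpsi.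
pose k x := `|phi 0%N x| + `|psi 0%N x|.
have ik : mu.-integrable setT (EFin \o k).
  exact: (integrableD measurableT iphi ipsi).
have mk : borel (EFin \o k) by exact: measurable_int ik.
have psig' : (int_R0 (psi n))%:E @[n --> \oo] -->
    (\int[mu]_x (g' x + (k x)%:E) - \int[mu]_x (k x)%:E)%E.
  by apply: g'cvg => // x; rewrite lerDr.
rewrite (cvg_unique _ psicvg psig')//.
have -> : (\int[mu]_x (g' x + (k x)%:E) = \int[mu]_x (g x + (k x)%:E))%E.
  apply: ae_eq_integral_R.
  - exact: (emeasurable_funD mg' mk).
  - exact: (emeasurable_funD mg mk).
  - by move: fg fg'; apply: aeS2_R => x -> ->.
by apply: gcvg => // x; rewrite lerDl.
Qed.

Lemma int_R1_lebesgue (f : R -> \bar R) : in_R1 f ->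
  exists (g : R -> \bar R) (h0 : R -> R), [/\ borel g,
    almost_everywhere_R (fun x => f x = g x),
    mu.-integrable setT (EFin \o h0),
    forall x, 0 <= h0 x /\ ((- h0 x)%:E <= g x)%E &
    forall h : R -> R, mu.-integrable setT (EFin \o h) ->
      (forall x, h0 x <= h x) ->
      int_R1 f = (\int[mu]_x (g x + (h x)%:E) - \int[mu]_x (h x)%:E)%E].
Proof.
move=> [phi fphi]; have [g [mg fg g_ge gcvg]] := R1_approx_lebesgue fphi.
exists g, (fun x => `|phi 0%N x|); split => //.
  by apply: integrable_norm; apply: in_R0_integrable; exact: fphi.1.
by move=> h ih hge; exact: cvg_unique (int_R1_cvg fphi) (gcvg h ih hge).
Qed.

(** * Sets of the family and their Borel representatives *)

Lemma eq_indic (A B : set R) (x : R) : (A x <-> B x) -> \1_A x = \1_B x :> R.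
Proof.
move=> AB; rewrite !indicE.
by have -> : (x \in A) = (x \in B) by apply/idP/idP; rewrite !inE => /AB.
Qed.

Lemma integral_indicT (E : set (measurableTypeR R)) : measurable E ->
  (\int[mu]_x (\1_E x)%:E = mu E)%E.
Proof. by move=> mE; rewrite integral_indic// setIT. Qed.

Lemma borel_indic (E : set (measurableTypeR R)) : measurable E ->
  borel (EFin \o (\1_E : R -> R)).
Proof. by move=> mE; exact/measurable_EFinP/measurable_indic. Qed.

(** Borel versions [g1], [g2] of [f1], [f2] satisfy [chi A = g1 - g2] a.e., so [B] can be the set
    where this difference is 1. Shifting both by the same integrable [h] makes them nonnegative, and
    integrals may be added. *)
Lemma R2_decomp_chi_lebesgue (A : set R) (f1 f2 : R -> \bar R) :
  R2_decomp (chi A) f1 f2 ->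
  exists B : set (measurableTypeR R), [/\ measurable B,
    almost_everywhere_R (fun x => A x <-> B x) &
    (int_R1 f1 - int_R1 f2)%E = mu B].
Proof.
move=> [/int_R1_lebesgue[g1 [h1 [mg1 fg1 ih1 h1P int1]]]].
move=> /int_R1_lebesgue[g2 [h2 [mg2 fg2 ih2 h2P int2]]] fin12 Af.
pose h x := h1 x + h2 x.
have ih : mu.-integrable setT (EFin \o h).
  exact: (integrableD measurableT ih1 ih2).
have mh : borel (EFin \o h) by exact: measurable_int ih.
have h1h x : h1 x <= h x by rewrite lerDl (h2P x).1.
have h2h x : h2 x <= h x by rewrite lerDr (h1P x).1.
have g1h x : (0 <= g1 x + (h x)%:E)%E.
  have [_ h1g] := h1P x; rewrite -[0%E]/((0 : R)%:E) -(addNr (h x)) EFinD.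
  by apply: leeD => //; apply: le_trans h1g; rewrite lee_fin lerN2.
have g2h x : (0 <= g2 x + (h x)%:E)%E.
  have [_ h2g] := h2P x; rewrite -[0%E]/((0 : R)%:E) -(addNr (h x)) EFinD.
  by apply: leeD => //; apply: le_trans h2g; rewrite lee_fin lerN2.
pose B : set (measurableTypeR R) := [set x | (g1 x - g2 x = 1)%E].
have mB : measurable B.
  rewrite -[B]setTI.
  exact: (emeasurable_funB mg1 mg2 measurableT (emeasurable_set1 1%E)).
have Ag : almost_everywhere_R (fun x => chi A x = (g1 x - g2 x)%E).
  have fg12 : almost_everywhere_R (fun x => f1 x = g1 x /\ f2 x = g2 x).
    by move: fg1 fg2; apply: aeS2_R.
  by move: Af fg12; apply: aeS2_R => x -> [-> ->].
have AB x : chi A x = (g1 x - g2 x)%E -> A x <-> B x.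
  rewrite /B/= => <-; rewrite /chi indicE.
  have [Ax|Ax] := pselect (A x); first by rewrite mem_set.
  rewrite memNset//; split => // -[/eqP].
  by rewrite eq_sym oner_eq0.
exists B; split => //; first by move: Ag; exact: aeS_R.
(* Written additively since [mu B] and one of the integrals may be infinite. *)
have gE : (\int[mu]_x (g1 x + (h x)%:E) =
    mu B + \int[mu]_x (g2 x + (h x)%:E))%E.
  rewrite -integral_indicT// -ge0_integralD//; last 2 first.
  - exact: (borel_indic mB).
  - exact: (emeasurable_funD mg2 mh).
  apply: ae_eq_integral_R.
  - exact: (emeasurable_funD mg1 mh).
  - exact: (emeasurable_funD (borel_indic mB) (emeasurable_funD mg2 mh)).
  - move: Ag; apply: aeS_R => x Agx.
    rewrite /= -(eq_indic (AB x Agx)).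
    move: Agx (h1P x) (h2P x); rewrite /chi.
    (* A difference with an infinite term is infinite, also by convention for [+oo - +oo]; as
       [chi A x] is real, both values are real. *)
    move: (g1 x) (g2 x) => [a| |] [b| |] // [->] _ _.
    by rewrite -!EFinD -addrA addKr.
rewrite (int1 h)// (int2 h)// in fin12 *.
rewrite gE in fin12 *.
have : (0 <= mu B)%E by [].
have : (0 <= \int[mu]_x (g2 x + (h x)%:E))%E by exact: integral_ge0.
have : (\int[mu]_x (h x)%:E)%E \is a fin_num by exact: integrable_fin_num.
(* If the integral of [g2 + h] were infinite, both [int_R1 f1] and [int_R1 f2] would be, against
   [fin12]. Being finite it cancels, even when [mu B] is infinite. *)
move: fin12; move: (mu B) (\int[mu]_x (g2 x + _)%E)%E (\int[mu]_x (h x)%:E)%E.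
move=> [m| |] [b| |] [c| |] //=; try by case.
by move=> _ _ _ _; rewrite -!EFinD; congr (_%:E); rewrite opprB addrA subrK addrK.
Qed.

Lemma R2_sets_borel (A : set R) : R2_sets R A ->
  exists2 B : set (measurableTypeR R), measurable B &
    almost_everywhere_R (fun x => A x <-> B x).
Proof.
by move=> [f1 [f2 /R2_decomp_chi_lebesgue[B [mB AB _]]]]; exists B.
Qed.

(** The decomposition chosen by [int_R2] has its own Borel set [C], but [C] and [B] both agree with
    [A] a.e., so their measures coincide. Leaving [B] free allows the representative to be adjusted
    later. *)
Lemma R2_measure_lebesgue (A : set R) (B : set (measurableTypeR R)) :
  R2_sets R A -> measurable B -> almost_everywhere_R (fun x => A x <-> B x) ->
  R2_measure R A = mu B.
Proof.
move=> [f1 [f2 Af]] mB AB; rewrite /R2_measure /int_R2.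
case: xgetP => [v _ [k1 [k2 [Ak ->]]]|/(_ (int_R1 f1 - int_R1 f2)%E)[]]; last first.
  by exists f1, f2.
have [C [mC AC ->]] := R2_decomp_chi_lebesgue Ak.
rewrite -!integral_indicT//.
apply: ae_eq_integral_R; [exact: borel_indic..|].
move: AB AC; apply: aeS2_R => x AB AC; congr (_%:E).
by apply: eq_indic; rewrite -AB -AC.
Qed.

(** * Null sets and bounded intervals belong to the family *)

Lemma in_R0_R1 (phi : R -> R) : in_R0 phi ->
  in_R1 (EFin \o phi) /\ int_R1 (EFin \o phi) = (int_R0 phi)%:E.
Proof.
move=> phiR0; have approx : R1_approx (EFin \o phi) (fun=> phi).
  split=> //; apply/ae_measurable_R; exists set0; split => // x _.
  by split=> //; exact: cvg_cst.
split; first by exists (fun=> phi).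
exact: cvg_unique (int_R1_cvg approx) (cvg_cst _).
Qed.

Lemma R2_sets_ae_R0 (A : set R) (phi : R -> R) : in_R0 phi ->
  almost_everywhere_R (fun x => chi A x = (phi x)%:E) -> R2_sets R A.
Proof.
move=> /in_R0_R1[phiR1 phiE] Aphi.
have [zR1 zE] : in_R1 (EFin \o cst (0 : R)) /\
    int_R1 (EFin \o cst (0 : R)) = (int_R0 (cst (0 : R)))%:E.
  by apply: in_R0_R1; exists [::]; split => // x; rewrite big_nil.
exists (EFin \o phi), (EFin \o cst 0); split => //.
  by left; rewrite phiE.
by move: Aphi; apply: aeS_R => x ->; rewrite /= sube0.
Qed.

Lemma R2_sets_null (N : set R) : is_null_set N -> R2_sets R N.
Proof.
move=> N0; apply: (@R2_sets_ae_R0 _ (cst 0)).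
  by exists [::]; split => // x; rewrite big_nil.
by exists N => // x Nx; rewrite /chi indicE memNset.
Qed.

Lemma R2_sets_itv (i : interval R) : itv_bounded i -> R2_sets R [set` i].
Proof.
move=> bi; apply: (@R2_sets_ae_R0 _ \1_[set` i]).
  by exists [:: (1, i)]; split => [|x]; rewrite ?big_seq1 ?mul1r //= bi.
by apply/ae_measurable_R; exists set0; split.
Qed.

End LebesgueComparison.

Theorem theorem4p3 (R : realType) :
  [/\ is_measure_on (R2_sets R) (R2_measure R),
      is_sigma_finite_on (R2_sets R) (R2_measure R) &
      is_complete_on (R2_sets R) (R2_measure R)].
Proof.
have R2_set0 : R2_sets R set0.
  by apply: R2_sets_null; apply/null_set_negligible; exact: negligible_set0.
have aeE (A B : set R) : A = B -> almost_everywhere_R (fun x => A x <-> B x).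
  by move=> ->; apply/ae_measurable_R; exists set0; split.
split.
- split => //.
  + move=> A AR; have [B mB AB] := R2_sets_borel AR.
    by rewrite (R2_measure_lebesgue AR mB AB).
  + by rewrite (R2_measure_lebesgue R2_set0 measurable0) ?measure0//; exact: aeE.
  + move=> F FR tF UFR.
    have /choice[B BP] : forall n, exists B : set (measurableTypeR R),
        measurable B /\ almost_everywhere_R (fun x => F n x <-> B x).
      by move=> n; have [B mB FB] := R2_sets_borel (FR n); exists B.
    have /ae_measurable_R[Z [mZ Z0 ZFB]] := ae_foralln_R (fun n => (BP n).2).
    (* The sets [B n] are disjoint only up to null sets. Off [Z] they coincide with the disjoint
       [F n], so the [C n] are truly disjoint. *)
    pose C n := B n `\` Z.
    have mC n : measurable (C n) by apply: measurableD => //; exact: (BP n).1.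
    have FC n x : ~ Z x -> F n x <-> C n x.
      by move=> Zx; rewrite (ZFB x Zx n); split => [|[]].
    have aeZ (P : R -> Prop) : (forall x, ~ Z x -> P x) -> almost_everywhere_R P.
      by move=> ZP; apply/ae_measurable_R; exists Z.
    have mUC : measurable (\bigcup_n C n) by exact: bigcupT_measurable.
    rewrite (R2_measure_lebesgue UFR mUC); last first.
      by apply: aeZ => x Zx; split => -[n _ /(FC n x Zx) Cnx]; exists n.
    rewrite measure_semi_bigcup//.
      apply: eq_eseriesr => n _; apply/esym/R2_measure_lebesgue => //.
      by apply: aeZ => x; exact: FC.
    move=> i j _ _ [x [[Bix Zx] [Bjx _]]]; apply: tF => //.
    by exists x; split; exact/(ZFB x Zx).
- move=> A AR; exists (fun n => [set` `[- n%:R, n%:R : R]]) => [n|x Ax].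
    have nR : R2_sets R [set` `[- n%:R, n%:R]] by exact: R2_sets_itv.
    split=> //; rewrite (R2_measure_lebesgue nR _ (aeE _ _ erefl))//.
    by rewrite lebesgue_measure_itv/=; case: ifP; rewrite ?ltry.
  exists (Num.truncn `|x|).+1 => //=.
  by rewrite in_itv/= -ler_norml ltW// truncnS_gt.
- move=> A N AR A0 NA; apply/R2_sets_null/null_set_negligible.
  have [B mB AB] := R2_sets_borel AR.
  have /ae_measurable_R[Z [mZ Z0 ZAB]] := AB.
  have B0 := R2_measure_lebesgue AR mB AB.
  (* Outside [Z] the set [A] lies in [B], and [mu B] is the measure of [A], that is, zero; so [B]
     and [Z] together form a null set containing [N]. *)
  apply: (@negligibleS _ _ _ _ (B `|` Z)).
    move=> x /NA Ax; have [|Zx] := pselect (Z x); first by right.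
    by left; exact/(ZAB x Zx).
  by apply: negligibleU; apply/negligibleP => //; exact: etrans (esym B0) A0.
Qed.
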